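(* Let $n\ge 1$ be an integer and let $Y,\lambda_1,\dots,\lambda_{n+1},x_1,\dots,x_n$ be independent variables (commuting indeterminates). Then $$\sum_{\sigma\in S_{n+1}}\prod_{k=1}^n \frac{\lambda_{\sigma(1)}x_1+\cdots+\lambda_{\sigma(k)}x_k-Y}{\lambda_{\sigma(k)}-\lambda_{\sigma(k+1)}} =\prod_{k=1}^n(x_1+\cdots+x_k).$$
   Context: $S_{n+1}$ denotes the symmetric group of all permutations of $\{1,2,\dots,n+1\}$. The identity is one of rational functions (over $\mathbb{Q}$) in the indicated indeterminates. *)

(* Defs.v *)
From mathcomp Require Import all_boot all_order all_algebra all_fingroup.
From mathcomp Require Import mpoly.

Set Implicit Arguments.
Unset Strict Implicit.
Unset Printing Implicit Defensive.

Import GRing.Theory.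
Local Open Scope ring_scope.

(* Variables and positions are numbered from 0: index i stands for i + 1 in   *)
(* the usual notation lambda_1, ..., lambda_(n+1), x_1, ..., x_n.             *)

(* The 1 + (n + 1) + n indeterminates are laid out as                         *)
(* Y, lambda_1, ..., lambda_(n+1), x_1, ..., x_n.                             *)
Definition nvars (n : nat) : nat := (1 + (n.+1 + n))%N.

Definition idxY (n : nat) : 'I_(nvars n) := lshift (n.+1 + n) ord0.
Definition idxL (n : nat) (i : 'I_n.+1) : 'I_(nvars n) :=
  rshift 1 (lshift n i).
Definition idxX (n : nat) (j : 'I_n) : 'I_(nvars n) :=
  rshift 1 (rshift n.+1 j).

Notation ratfun n := {fraction {mpoly rat[nvars n]}}.

Definition varY (n : nat) : ratfun n :=
  tofrac ('X_(idxY n) : {mpoly rat[nvars n]}).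
Definition lam (n : nat) (i : 'I_n.+1) : ratfun n :=
  tofrac ('X_(idxL i) : {mpoly rat[nvars n]}).
Definition varx (n : nat) (j : 'I_n) : ratfun n :=
  tofrac ('X_(idxX j) : {mpoly rat[nvars n]}).

(* For k among the first n of the n + 1 positions: k itself, and k + 1.       *)
Definition pos (n : nat) (k : 'I_n) : 'I_n.+1 := widen_ord (leqnSn n) k.
Definition nextpos (n : nat) (k : 'I_n) : 'I_n.+1 := lift ord0 k.

(* Main.v *)
Require Import Defs.
From mathcomp Require Import all_boot all_order all_algebra all_fingroup.
From mathcomp Require Import mpoly.
From mathcomp Require Import ring.

(* For fixed i, the sum of the products over the permutations with sigma(1) = i
   equals
     prod_k ((x_1 + ... + x_k) lambda_i - Y) / prod_(j != i) (lambda_i - lambda_j).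
   Indeed, fixing sigma(1) = i turns the factors with k >= 2 into an instance of
   size n - 1, with x shifted and Y replaced by Y - lambda_i x_1; splitting that
   instance according to sigma(2) and using induction leaves a Lagrange
   interpolation sum, evaluated at lambda_i. Summing over i then gives, again by
   Lagrange interpolation, the leading coefficient of the polynomial
   prod_k ((x_1 + ... + x_k) z - Y) in z. *)

Set Implicit Arguments.
Unset Strict Implicit.
Unset Printing Implicit Defensive.

Import GRing.Theory.
Local Open Scope ring_scope.

Section Lagrange.

Variables (F : fieldType) (n : nat) (l : 'I_n.+1 -> F).
Hypothesis l_inj : injective l.

Lemma node_sub_neq0 i m : l i - l (lift i m) != 0.
Proof. by rewrite subr_eq0 (inj_eq l_inj) neq_lift. Qed.

Lemma node_prod_neq0 i : \prod_(m < n) (l i - l (lift i m)) != 0.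
Proof. by apply/prodf_neq0 => m _; exact: node_sub_neq0. Qed.

Lemma horner_node_prod (i : 'I_n.+1) z :
  (\prod_(m < n) ('X - (l (lift i m))%:P)).[z] = \prod_(m < n) (z - l (lift i m)).
Proof. by rewrite horner_prod; apply: eq_bigr => m _; rewrite hornerXsubC. Qed.

Lemma size_node_prod (i : 'I_n.+1) :
  size (\prod_(m < n) ('X - (l (lift i m))%:P)) = n.+1.
Proof. by rewrite size_prod_XsubC -[index_enum _]enumT size_enum_ord. Qed.

(** The difference of the two sides has size at most [n.+1] and vanishes at [n.+1] distinct nodes;
    [lift i m] runs through the indices other than [i]. *)
Lemma lagrange_interpolation (P : {poly F}) : (size P <= n.+1)%N ->
  P = \sum_(i < n.+1) (P.[l i] / \prod_(m < n) (l i - l (lift i m)))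
        *: \prod_(m < n) ('X - (l (lift i m))%:P).
Proof.
move=> szP; apply/eqP; rewrite -subr_eq0; apply/eqP.
apply: (@roots_geq_poly_eq0 _ _ [seq l i | i <- enum 'I_n.+1]).
- apply/allP => _ /mapP[i _ ->]; rewrite rootE hornerD hornerN horner_sum.
  rewrite (bigD1 i) //= hornerZ horner_node_prod divfK ?node_prod_neq0 //.
  rewrite big1 ?addr0 ?subrr // => j ji.
  rewrite hornerZ horner_node_prod; case: (unliftP j i) ji => [m ->|->] ji.
    by rewrite [X in _ * X](bigD1 m) //= subrr mul0r mulr0.
  by rewrite eqxx in ji.
- by rewrite map_inj_uniq ?enum_uniq.
rewrite size_map size_enum_ord (leq_trans (size_polyD _ _)) //.
rewrite geq_max szP size_polyN (leq_trans (size_sum _ _ _)) //.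
apply/bigmax_leqP => i _; rewrite (leq_trans (size_scale_leq _ _)) //.
by rewrite size_node_prod.
Qed.

(** Each node product is monic of degree [n], so comparing coefficients of degree [n] in the
    interpolation formula suffices. *)
Lemma lagrange_lead_coef (P : {poly F}) : (size P <= n.+1)%N ->
  \sum_(i < n.+1) P.[l i] / \prod_(m < n) (l i - l (lift i m)) = P`_n.
Proof.
move=> /lagrange_interpolation {2}->; rewrite coef_sum.
apply: eq_bigr => i _; rewrite coefZ.
have := lead_coef_prod_XsubC (index_enum 'I_n) xpredT (fun m => l (lift i m)).
by rewrite lead_coefE size_node_prod => ->; rewrite mulr1.
Qed.

Lemma lagrange_eval (P : {poly F}) z : (size P <= n.+1)%N ->
    (forall i, z - l i != 0) ->
  \sum_(i < n.+1) (z - l i)^-1 * (P.[l i] / \prod_(m < n) (l i - l (lift i m)))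
    = P.[z] / \prod_(i < n.+1) (z - l i).
Proof.
move=> /lagrange_interpolation {2}-> zl.
rewrite horner_sum mulr_suml; apply: eq_bigr => i _.
rewrite hornerZ horner_node_prod (bigD1_ord i) //=.
have zl_prod : \prod_(m < n) (z - l (lift i m)) != 0.
  by apply/prodf_neq0 => m _.
by field; rewrite zl_prod zl node_prod_neq0.
Qed.

End Lagrange.

(** Permutations are sorted by the image of [i0]. The parametrization is injective, hence bijective
    because (n+1) * n! = (n+1)!. *)
Lemma sum_lift_perm (V : nmodType) (n : nat) (f : 'S_n.+1 -> V) (i0 : 'I_n.+1) :
  \sum_(s : 'S_n.+1) f s = \sum_(i < n.+1) \sum_(s : 'S_n) f (lift_perm i0 i s).
Proof.
rewrite pair_big (reindex (fun p : 'I_n.+1 * 'S_n => lift_perm i0 p.1 p.2)) //.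
apply: onW_bij; apply: inj_card_bij => [[i s] [j t] /= /permP e|].
  have eij : i = j by have := e i0; rewrite !lift_perm_id.
  subst j; congr pair; apply/permP => k.
  by have := e (lift i0 k); rewrite !lift_perm_lift => /lift_inj.
by rewrite card_prod card_ord !card_Sn factS.
Qed.

Lemma sum_leq_ord0 (V : nmodType) n (f : 'I_n.+1 -> V) :
  \sum_(j < n.+1 | (j <= @ord0 n)%N) f j = f ord0.
Proof.
rewrite (bigD1 ord0) //= big1 ?addr0 // => j.
by case: (unliftP ord0 j) => [j' ->|->]; rewrite ?eqxx ?andbF.
Qed.

Lemma sum_leq_lift (V : nmodType) n (f : 'I_n.+1 -> V) (k : 'I_n) :
  \sum_(j < n.+1 | (j <= lift ord0 k)%N) f j =
  f ord0 + \sum_(j < n | (j <= k)%N) f (lift ord0 j).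
Proof. by rewrite big_mkcond big_ord_recl [in RHS]big_mkcond. Qed.

Section ChainProduct.

Variable F : fieldType.

Definition chain_prod n (l : 'I_n.+1 -> F) (x : 'I_n -> F) (Y : F)
    (s : 'S_n.+1) : F :=
  \prod_(k < n) ((\sum_(j < n | (j <= k)%N) l (s (pos j)) * x j - Y)
                   / (l (s (pos k)) - l (s (nextpos k)))).

(** The numerators of [chain_prod] with every value of [l] replaced by one unknown. *)
Definition level_poly n (x : 'I_n -> F) (Y : F) : {poly F} :=
  \prod_(k < n) ((\sum_(j < n | (j <= k)%N) x j) *: 'X - Y%:P).

Lemma size_level_factor (a Y : F) : (size (a *: 'X - Y%:P)%R <= 2)%N.
Proof.
rewrite (leq_trans (size_polyD _ _)) // geq_max size_polyN.
by rewrite (leq_trans (size_scale_leq _ _)) ?size_polyX //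
  (leq_trans (size_polyC_leq1 _)).
Qed.

(** The two claims go together: in the induction, the constant part [Y] of the new factor does not
    reach the top coefficient because of the size bound. Some [y k] may vanish, hence a coefficient
    of fixed degree instead of [lead_coef]. *)
Lemma size_coef_prod_linear n (y : 'I_n -> F) Y :
  let p := \prod_(k < n) (y k *: 'X - Y%:P) in
  (size p <= n.+1)%N /\ p`_n = \prod_(k < n) y k.
Proof.
elim: n y => [|n IH] y /=; first by rewrite !big_ord0 size_poly1 coef1.
rewrite !big_ord_recl /=; have [sz coef] := IH (fun k => y (lift ord0 k)).
split; last first.
  rewrite -coef mulrBl -scalerAl coefB coefZ coefXM mul_polyC coefZ /=.
  by rewrite (nth_default _ sz) mulr0 subr0.
rewrite (leq_trans (size_polyMleq _ _)) // -subn1 leq_subLR.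
exact: leq_add (size_level_factor _ _) sz.
Qed.

Lemma size_level_poly n (x : 'I_n -> F) Y : (size (level_poly x Y) <= n.+1)%N.
Proof.
by case: (size_coef_prod_linear (fun k : 'I_n => \sum_(j < n | (j <= k)%N) x j) Y).
Qed.

Lemma coef_level_poly n (x : 'I_n -> F) Y :
  (level_poly x Y)`_n = \prod_(k < n) \sum_(j < n | (j <= k)%N) x j.
Proof.
by case: (size_coef_prod_linear (fun k : 'I_n => \sum_(j < n | (j <= k)%N) x j) Y).
Qed.

(** The term [z * x ord0] occurs in every factor, so the later ones absorb it into [Y]. The new [Y]
    depends on [z], which is why values and not polynomials are compared. *)
Lemma level_poly_recl n (x : 'I_n.+1 -> F) Y z :
  (level_poly x Y).[z] =
  (z * x ord0 - Y)
    * (level_poly (fun j => x (lift ord0 j)) (Y - z * x ord0)).[z].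
Proof.
rewrite /level_poly !horner_prod big_ord_recl sum_leq_ord0; congr (_ * _).
  by rewrite !hornerE mulrC.
apply: eq_bigr => k _; rewrite !hornerE sum_leq_lift.
by rewrite mulrDl opprB addrCA addrA [x _ * z]mulrC addrC.
Qed.

(** The same absorption with [z = l i]; after the head [i], the permutation only meets the indices
    [lift i m]. *)
Lemma chain_prod_recl n (l : 'I_n.+2 -> F) (x : 'I_n.+1 -> F) Y i (s : 'S_n.+1) :
  chain_prod l x Y (lift_perm ord0 i s) =
  (l i * x ord0 - Y) / (l i - l (lift i (s ord0)))
  * chain_prod (fun m => l (lift i m)) (fun j => x (lift ord0 j))
      (Y - l i * x ord0) s.
Proof.
have pos0 : pos ord0 = ord0 :> 'I_n.+2 by apply: val_inj.
have posl (j : 'I_n) : pos (lift ord0 j) = lift ord0 (pos j) by apply: val_inj.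
have next0 : nextpos ord0 = lift ord0 ord0 :> 'I_n.+2 by apply: val_inj.
rewrite /chain_prod big_ord_recl sum_leq_ord0; congr (_ * _).
  by rewrite pos0 next0 lift_perm_lift lift_perm_id.
apply: eq_bigr => k _; rewrite sum_leq_lift pos0 posl /nextpos.
rewrite !lift_perm_lift lift_perm_id opprB; congr (_ / _).
rewrite (eq_bigr (fun j => l (lift i (s (pos j))) * x (lift ord0 j))).
  by rewrite [RHS]addrCA addrA.
by move=> j _; rewrite posl lift_perm_lift.
Qed.

Lemma sum_chain_prod_fixed_head n (l : 'I_n.+1 -> F) (x : 'I_n -> F) Y i :
    injective l ->
  \sum_(s : 'S_n) chain_prod l x Y (lift_perm ord0 i s) =
  (level_poly x Y).[l i] / \prod_(m < n) (l i - l (lift i m)).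
Proof.
elim: n l x Y i => [|n IH] l x Y i l_inj.
  rewrite /level_poly !big_ord0 hornerC divr1.
  under eq_bigr do rewrite /chain_prod big_ord0.
  by rewrite sumr_const card_Sn.
under eq_bigr do rewrite chain_prod_recl -mulrA.
rewrite -mulr_sumr level_poly_recl -mulrA; congr (_ * _).
have lift_l_inj : injective (fun m => l (lift i m)).
  by move=> a b /l_inj/lift_inj.
(* The right side becomes an interpolation sum over the nodes other than [l i], evaluated at
   [l i]. *)
rewrite -(lagrange_eval lift_l_inj); first last.
- by move=> m; apply: node_sub_neq0.
- exact: size_level_poly.
(* Here [lift i m] is the second value of the permutation; it fixes the first denominator, which
   leaves the sum over [s]. *)
rewrite (sum_lift_perm _ ord0); apply: eq_bigr => m _.
rewrite -(IH (fun m => l (lift i m))) // mulr_sumr.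
by apply: eq_bigr => s _; rewrite lift_perm_id.
Qed.

Lemma sum_chain_prod n (l : 'I_n.+1 -> F) (x : 'I_n -> F) Y : injective l ->
  \sum_(s : 'S_n.+1) chain_prod l x Y s =
  \prod_(k < n) \sum_(j < n | (j <= k)%N) x j.
Proof.
move=> l_inj; rewrite -(coef_level_poly x Y).
rewrite (sum_lift_perm _ ord0) -(lagrange_lead_coef l_inj (size_level_poly x Y)).
by apply: eq_bigr => i _; exact: sum_chain_prod_fixed_head.
Qed.

End ChainProduct.

Lemma lam_inj n : injective (@lam n).
Proof.
move=> i j /eqP; rewrite /lam tofrac_eq => /eqP.
(* The coefficient at the monomial of [idxL j] tells the indeterminates apart: it is 1 on the right,
   and 0 on the left unless the indices agree. *)
move/(congr1 (fun p : {mpoly rat[nvars n]} => p@_(U_(idxL j))%MM)).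
rewrite !mcoeffXU eqxx; case: eqP => [/rshift_inj/lshift_inj // | _ /eqP].
by rewrite eq_sym oner_eq0.
Qed.

Theorem corollary14 (n : nat) (hn : (1 <= n)%N) :
  \sum_(s : 'S_n.+1) \prod_(k < n)
    ((\sum_(j < n | (j <= k)%N) lam (s (pos j)) * varx j - varY n)
       / (lam (s (pos k)) - lam (s (nextpos k))))
  = \prod_(k < n) \sum_(j < n | (j <= k)%N) varx j :> ratfun n.
Proof. exact: sum_chain_prod (@varx n) (varY n) (@lam_inj n). Qed.
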